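(* Let $p$ be an odd positive integer and $G$ a graph. Set $q=\mathrm{wcol}_p(G)$. (a) We have $\chi(G^{[\natural p]})\le\bigl(\bigl\lfloor\frac12p\bigr\rfloor+2\bigr)^q$. (b) If $G$ has odd girth at least $p+1$, then $\chi(G^{\natural p})\le\bigl(\bigl\lfloor\frac12p\bigr\rfloor+2\bigr)^q$.
   Context: All graphs are finite, undirected, simple and without loops. $\chi$ denotes the chromatic number. The length of a path is its number of edges. For a graph $G=(V,E)$ and a positive integer $p$: the exact distance-$p$ graph $G^{[\natural p]}$ has vertex set $V$, and $xy$ is an edge if and only if the distance between $x$ and $y$ in $G$ is exactly $p$; the exact $p$-power graph $G^{\natural p}$ has vertex set $V$, and $xy$ (with $x\neq y$) is an edge if and only if there is in $G$ a path (no repeated vertices, not necessarily a shortest path) of length exactly $p$ between $x$ and $y$. The odd girth of $G$ is the length of a shortest odd cycle (infinite if there is none). Weak colouring numbers: let $L$ be a linear ordering of $V$ and $k$ a positive integer. A vertex $x$ is weakly $k$-accessible from $y$ if $x<_L y$ and there is an $xy$-path of length at most $k$ all of whose internal vertices $z$ satisfy $x<_L z$. Let $Q_{L,k}(y)$ be the set of vertices weakly $k$-accessible from $y$, and $\mathrm{wcol}_k(G)=1+\min_L\max_{y\in V}|Q_{L,k}(y)|$, the minimum being over all linear orderings $L$ of $V$. *)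

(* Defs.v *)
From mathcomp Require Import all_boot.

Set Implicit Arguments.
Unset Strict Implicit.
Unset Printing Implicit Defensive.

Record sgraph := SGraph {
  vertex :> finType;
  adj : rel vertex;
  adj_sym : symmetric adj;
  adj_irr : irreflexive adj }.

Definition proper_coloring (G : sgraph) (k : nat) (f : {ffun G -> 'I_k}) :=
  [forall x, forall y, adj x y ==> (f x != f y)].

Definition colorable (G : sgraph) (k : nat) : bool :=
  [exists f : {ffun G -> 'I_k}, proper_coloring f].

Lemma colorable_ex (G : sgraph) : exists k, colorable G k.
Proof.
exists #|G|; apply/existsP; exists [ffun x => enum_rank x].
apply/'forall_forallP => x y; apply/implyP => xy; rewrite !ffunE.
by apply: contraTneq xy => /enum_rank_inj ->; rewrite adj_irr.
Qed.

Definition chi (G : sgraph) : nat := ex_minn (colorable_ex G).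

(* [x :: s] is the vertex sequence of a path, so its length is [size s]. *)
Definition is_path (G : sgraph) (x y : G) (s : seq G) : bool :=
  [&& path (@adj G) x s, uniq (x :: s) & last x s == y].

Definition has_path (G : sgraph) (k : nat) (x y : G) : bool :=
  [exists s : k.-tuple G, is_path x y s].

Lemma has_path_sym (G : sgraph) k : symmetric (@has_path G k).
Proof.
have sub (x y : G) : has_path k x y -> has_path k y x.
  case/existsP=> s /and3P[ps us /eqP ls]; apply/existsP.
  have sz : size (rev (belast x s)) == k.
    by rewrite size_rev size_belast size_tuple.
  exists (Tuple sz); rewrite /is_path /= -ls; apply/and3P; split.
  - by rewrite rev_path (eq_path (e' := @adj G)) // => a b; rewrite adj_sym.
  - by rewrite -/(uniq (_ :: _)) -rev_rcons -lastI rev_uniq.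
  - by case: (tval s) => //= a t; rewrite rev_cons last_rcons.
by move=> x y; apply/idP/idP; apply: sub.
Qed.

(* A path has at most [#|G| - 1] edges, and [iota] is increasing: this is the
   length of a shortest path, or [None] (infinity) if there is none. *)
Definition dist (G : sgraph) (x y : G) : option nat :=
  ohead [seq k <- iota 0 #|G| | has_path k x y].

(* The condition [x != y] is redundant for [0 < p]; it makes the graph loopless
   for every [p]. *)
Definition exact_dist_rel (G : sgraph) (p : nat) : rel G :=
  [rel x y | (x != y) && (dist x y == Some p)].

Lemma exact_dist_sym (G : sgraph) p : symmetric (@exact_dist_rel G p).
Proof.
move=> x y; rewrite /exact_dist_rel /= eq_sym /dist; congr (_ && (ohead _ == _)).
by apply: eq_filter => k; rewrite has_path_sym.
Qed.

Lemma exact_dist_irr (G : sgraph) p : irreflexive (@exact_dist_rel G p).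
Proof. by move=> x; apply/andP=> -[/eqP]. Qed.

Definition exact_dist_graph (G : sgraph) (p : nat) : sgraph :=
  SGraph (@exact_dist_sym G p) (@exact_dist_irr G p).

Definition exact_power_rel (G : sgraph) (p : nat) : rel G :=
  [rel x y | (x != y) && has_path p x y].

Lemma exact_power_sym (G : sgraph) p : symmetric (@exact_power_rel G p).
Proof. by move=> x y; rewrite /exact_power_rel /= eq_sym has_path_sym. Qed.

Lemma exact_power_irr (G : sgraph) p : irreflexive (@exact_power_rel G p).
Proof. by move=> x; apply/andP=> -[/eqP]. Qed.

Definition exact_power_graph (G : sgraph) (p : nat) : sgraph :=
  SGraph (@exact_power_sym G p) (@exact_power_irr G p).

Definition has_cycle (G : sgraph) (n : nat) : bool :=
  (2 < n) && [exists c : n.-tuple G, cycle (@adj G) c && uniq c].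

(* [None] stands for infinity; cycles have at most [#|G|] edges. *)
Definition odd_girth (G : sgraph) : option nat :=
  ohead [seq n <- iota 0 #|G|.+1 | odd n && has_cycle G n].

Definition odd_girth_geq (G : sgraph) (n : nat) : bool :=
  if odd_girth G is Some g then n <= g else true.

(* A strict linear order, encoded by its graph so that there are finitely many:
   [(x, y) \in L] means [x <_L y]. *)
Definition linear_order (V : finType) (L : {set V * V}) : bool :=
  [&& [forall x, (x, x) \notin L],
      [forall x, forall y, forall z,
         ((x, y) \in L) && ((y, z) \in L) ==> ((x, z) \in L)]
    & [forall x, forall y, (x != y) ==> ((x, y) \in L) || ((y, x) \in L)]].

(* [behead (belast x s)] lists the internal vertices of the path [x :: s]. *)
Definition weakly_accessible (G : sgraph) (L : {set G * G}) (k : nat)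
    (y x : G) : bool :=
  ((x, y) \in L) &&
  [exists n : 'I_k.+1, exists s : n.-tuple G,
     is_path x y s && all (fun z => (x, z) \in L) (behead (belast x s))].

Definition weak_reach (G : sgraph) (L : {set G * G}) (k : nat) (y : G) :
    {set G} :=
  [set x | weakly_accessible L k y x].

Definition max_weak_reach (G : sgraph) (L : {set G * G}) (k : nat) : nat :=
  \max_(y : G) #|weak_reach L k y|.

Lemma max_weak_reach_ex (G : sgraph) (k : nat) :
  exists m, [exists L : {set G * G}, linear_order L && (max_weak_reach L k == m)].
Proof.
pose L := [set u : G * G | enum_rank u.1 < enum_rank u.2].
exists (max_weak_reach L k); apply/existsP; exists L; rewrite eqxx andbT.
apply/and3P; split.
- by apply/forallP=> x; rewrite inE ltnn.
- apply/'forall_'forall_forallP => x y z; apply/implyP; rewrite !inE /=.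
  by case/andP; apply: ltn_trans.
- apply/'forall_forallP => x y; apply/implyP; rewrite !inE /= -neq_ltn.
  by apply: contraNneq => /val_inj/enum_rank_inj ->.
Qed.

Definition wcol (k : nat) (G : sgraph) : nat :=
  1 + ex_minn (max_weak_reach_ex G k).

(* Main.v *)
Require Import Defs.
From mathcomp Require Import all_boot.
From mathcomp Require Import zify.

(** Fix an ordering realizing [q = wcol_p G] and colour [G] greedily with [q]
  colours so that every vertex differs from the vertices weakly [p]-accessible
  from it.  Give [x] the vector whose entry at a colour [c] is the least
  [j <= p/2] such that a vertex of colour [c] is reached from [x] by a weak walk
  of length [j], and [p/2 + 1] if there is none.  Let [z] be the minimum of a
  path of length [p] from [x] to [y], at distance [i <= p/2] from [x] along it,
  and suppose that [x] and [y] have the same entry [j <= i] at the colour of [z].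
  Two vertices reached from a common vertex by weak walks of total length at most
  [p] have different colours, so both entries are witnessed by [z] itself.  Hence
  [x] and [y] are joined by a walk of length [2j < p], contradicting
  [dist x y = p]; and one of the closed walks [z..x..z] and [z..y..z], of lengths
  [i + j] and [p - i + j], is odd of length at most [p], contradicting the odd
  girth condition. *)

Set Implicit Arguments.
Unset Strict Implicit.
Unset Printing Implicit Defensive.

Lemma not_uniq_split (T : eqType) (s : seq T) :
  ~~ uniq s -> exists x s1 s2 s3, s = s1 ++ x :: s2 ++ x :: s3.
Proof.
elim: s => //= a s IH; rewrite negb_and negbK => /orP[|/IH].
  by case/splitPr=> s2 s3; exists a, [::], s2, s3.
by case=> x [s1 [s2 [s3 ->]]]; exists x, (a :: s1), s2, s3.
Qed.

(** Filtering keeps [iota] increasing, so the head is the least solution. Both [dist] and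
    [odd_girth] have this form. *)
Lemma ohead_filter_iota (P : pred nat) m k :
  k < m -> P k -> exists2 g, ohead [seq i <- iota 0 m | P i] = Some g & g <= k.
Proof.
move=> km Pk; have : k \in [seq i <- iota 0 m | P i].
  by rewrite mem_filter Pk mem_iota.
have : sorted leq [seq i <- iota 0 m | P i].
  by apply: sorted_filter; [exact: leq_trans | exact: iota_sorted].
case: [seq i <- iota 0 m | P i] => //= g s.
rewrite path_sortedE; last exact: leq_trans.
case/andP=> /allP gs _; rewrite inE => ks; exists g => //.
by case/orP: ks => [/eqP-> //|/gs].
Qed.

Lemma greedy_coloring (T : finType) (Q : T -> {set T}) (r : T -> nat) m :
    (forall x y, x \in Q y -> r x < r y) -> (forall y, #|Q y| <= m) ->
  exists a : T -> 'I_m.+1, forall x y, x \in Q y -> a x != a y.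
Proof.
move=> rQ Qm.
suff /(_ (\max_y r y).+1) [a Ha] n : exists a : T -> 'I_m.+1,
    forall x y, r y < n -> x \in Q y -> a x != a y.
  by exists a => x y; apply: Ha; rewrite ltnS leq_bigmax.
elim: n => [|n [a Ha]]; first by exists (fun=> ord0).
have freeP y : exists c, c \notin a @: Q y.
  apply/existsP; rewrite -negb_forall; apply/negP => /forallP full.
  have := leq_trans (leq_imset_card a (Q y)) (Qm y).
  by rewrite (eq_card (B := 'I_m.+1)) ?card_ord ?ltnn.
(* Only vertices of rank [n] are recoloured. Members of [Q y] have smaller rank than [y], so they
   keep the colours that the free colour avoids. *)
exists (fun y => if r y == n then xchoose (freeP y) else a y) => x y.
rewrite ltnS leq_eqVlt => /orP[/eqP ryn|ryn] xy; have rxy := rQ _ _ xy.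
  rewrite ryn eqxx (ltn_eqF (leq_trans rxy _)) ?ryn //.
  apply: contraNneq (xchooseP (freeP y)) => <-.
  exact: imset_f.
by rewrite (ltn_eqF ryn) (ltn_eqF (ltn_trans rxy ryn)) Ha.
Qed.

(** The rank of a vertex is its number of predecessors; it grows strictly along [L] by transitivity
    and irreflexivity. *)
Lemma linear_order_rank (V : finType) (L : {set V * V}) :
    linear_order L ->
  exists2 r : V -> nat, injective r & forall x y, ((x, y) \in L) = (r x < r y).
Proof.
case/and3P=> /forallP irrL /'forall_'forall_forallP trL /'forall_forallP totL.
pose r x := #|[set u | (u, x) \in L]|.
have rL x y : (x, y) \in L -> r x < r y.
  move=> xy; apply: proper_card; apply/properP; split.
    apply/subsetP => u; rewrite !inE => ux.
    by have := trL u x y; rewrite ux xy.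
  by exists x; rewrite !inE.
exists r => [x y rxy|x y].
  apply/eqP; apply: contraPT rxy => /(implyP (totL x y)).
  by case/orP=> /rL; lia.
apply/idP/idP => [/rL //|rxy].
have /(implyP (totL x y))/orP[//|/rL] : x != y by apply: contraTneq rxy => ->; lia.
lia.
Qed.

Lemma chi_leq_card (G : sgraph) (T : finType) (f : G -> T) :
  (forall x y, adj x y -> f x != f y) -> chi G <= #|T|.
Proof.
move=> fP; rewrite /chi; case: ex_minnP => k _; apply.
apply/existsP; exists [ffun x => enum_rank (f x)].
apply/'forall_forallP => x y; apply/implyP => /fP; rewrite !ffunE.
by apply: contraNneq => /enum_rank_inj ->.
Qed.

Section Walks.

Variable G : sgraph.
Implicit Types (P : pred G) (x y z : G).

Definition walk P n x y : bool :=
  [exists s : n.-tuple G,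
     [&& path (@adj G) x s, last x s == y & all P (x :: s)]].

Lemma walkP P n x y :
  reflect (exists s, [/\ size s = n, path (@adj G) x s, last x s = y
                       & all P (x :: s)])
          (walk P n x y).
Proof.
apply: (iffP existsP) => [[s /and3P[ps /eqP ls Ps]]|[s [/eqP sn ps <- Ps]]].
  by exists s; rewrite size_tuple.
by exists (Tuple sn); rewrite ps eqxx.
Qed.

Lemma walk_sub P1 P2 n x y : subpred P1 P2 -> walk P1 n x y -> walk P2 n x y.
Proof.
move=> P12 /walkP[s [sn ps ls Ps]]; apply/walkP; exists s; split=> //.
exact: sub_all Ps.
Qed.

Lemma walk_cat P m n x y z :
  walk P m x y -> walk P n y z -> walk P (m + n) x z.
Proof.
case/walkP=> s [<- ps <- Ps] /walkP[t [<- pt <- /andP[_ Pt]]].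
by apply/walkP; exists (s ++ t); rewrite size_cat cat_path ps last_cat
  -cat_cons all_cat Ps.
Qed.

Lemma walk_rev P n x y : walk P n x y -> walk P n y x.
Proof.
case/walkP=> s [sn ps <- Ps]; apply/walkP; exists (rev (belast x s)); split.
- by rewrite size_rev size_belast.
- by rewrite rev_path (eq_path (e' := @adj G)) // => a b; rewrite adj_sym.
- by case: s {sn ps Ps} => //= a t; rewrite rev_cons last_rcons.
- by rewrite -rev_rcons all_rev -lastI.
Qed.

Lemma walk_is_path P n x y : walk P n x y ->
  exists s, [/\ size s <= n, is_path x y s & all P (x :: s)].
Proof.
case/walkP=> s [<- ps <- /andP[Px Ps]]; case/shortenP: ps => t pt ut ts.
exists t; split.
- by apply: uniq_leq_size ts; case/andP: ut.
- by rewrite /is_path pt ut eqxx.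
- by rewrite /= Px; apply/allP => u /ts; apply: (allP Ps).
Qed.

Lemma dist_has_path p x y : dist x y = Some p -> has_path p x y.
Proof.
rewrite /dist; case E: [seq _ <- _ | _] => [//|g s] [<-].
by have := mem_head g s; rewrite -E mem_filter => /andP[].
Qed.

Lemma dist_le_walk p n x y : dist x y = Some p -> walk predT n x y -> p <= n.
Proof.
move=> d /walk_is_path[s [sn ps _]]; apply: leq_trans sn.
(* [dist] searches only lengths below [#|G|]. *)
have us : size (x :: s) <= #|G|.
  by case/and3P: ps => _ us _; rewrite -(card_uniqP us) max_card.
have hs : has_path (size s) x y by apply/existsP; exists (in_tuple s).
by have [g] := ohead_filter_iota (P := fun k => has_path k x y) us hs; rewrite -/(dist x y) d => -[->].
Qed.

(** A closed walk that repeats a vertex splits there into two shorter closed walks, one of which is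
    odd. Without repetition, only length 1 must be excluded, and there are no loops. *)
Lemma odd_cycle (s : seq G) : cycle (@adj G) s -> odd (size s) ->
  exists2 n, n <= size s & odd n && has_cycle G n.
Proof.
have [m] := ubnP (size s); elim: m s => // m IH s; rewrite ltnS => sm cs os.
have [us|/not_uniq_split[x [s1 [s2 [s3 def_s]]]]] := boolP (uniq s).
  exists (size s); rewrite // os andTb; apply/andP; split.
    case: s cs os {us sm} => [|a [|b [|c s]]] //=.
    by rewrite adj_irr.
  by apply/existsP; exists (in_tuple s); rewrite cs.
have def_r : rot (size s1) s = (x :: s2) ++ x :: (s3 ++ s1).
  by rewrite def_s rot_size_cat /= -catA.
have sz : size (x :: s2) + size (x :: (s3 ++ s1)) = size s.
  by rewrite -size_cat -def_r size_rot.
have [c1 c2] : cycle (@adj G) (x :: s2) /\ cycle (@adj G) (x :: (s3 ++ s1)).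
  apply/andP; move: cs; rewrite -(rot_cycle (size s1)) def_r /=.
  by rewrite rcons_cat cat_path /= !rcons_path !andbA.
have [o1|o2] : odd (size (x :: s2)) \/ odd (size (x :: (s3 ++ s1))).
  by apply/orP; move: os; rewrite -sz oddD; do 2!case: odd.
- have [|n nle ?] := IH _ _ c1 o1; first by move: sz sm => /=; lia.
  by exists n; rewrite // (leq_trans nle) // -sz leq_addr.
- have [|n nle ?] := IH _ _ c2 o2; first by move: sz sm => /=; lia.
  by exists n; rewrite // (leq_trans nle) // -sz leq_addl.
Qed.

Lemma odd_girth_walk p n x :
  odd_girth_geq G p.+1 -> odd n -> walk predT n x x -> p < n.
Proof.
move=> og on /walkP[s [sn ps ls _]].
have [||k ks /andP[ok ck]] := @odd_cycle s.
- by rewrite (cycle_path x); case: s ls ps {sn} => //= a s ->.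
- by rewrite sn.
have kG : k < #|G|.+1.
  case/andP: (ck) => _ /existsP[c /andP[_ uc]].
  by rewrite ltnS -{1}(size_tuple c) -(card_uniqP uc) max_card.
have okck : odd k && has_cycle G k by rewrite ok.
have [g] := ohead_filter_iota (P := fun n => odd n && has_cycle G n) kG okck.
rewrite -/(odd_girth G); move: og; rewrite /odd_girth_geq.
by case: (odd_girth G) => // g' pg [<-]; rewrite -sn; lia.
Qed.

End Walks.

Section WeakWalks.

Variables (G : sgraph) (L : {set G * G}) (r : G -> nat).
Hypotheses (r_inj : injective r)
  (rL : forall x y, ((x, y) \in L) = (r x < r y)).

(* All vertices of a weak walk from [x] to [z] are at least [z]; unlike in
   [weakly_accessible], [x = z] is allowed. *)
Definition weak_walk n x z := walk (fun v => r z <= r v) n x z.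

(** Shortening the walk to a path leaves [z] only at its end, so by injectivity of [r] all other
    vertices are strictly above [z]. *)
Lemma weak_walk_accessible p n x z :
  weak_walk n x z -> n <= p -> x != z -> z \in weak_reach L p x.
Proof.
move=> /walk_rev/walk_is_path[s [sn ps Ps]] np xz.
have [_ us /eqP ls] := and3P ps.
have neq v : v != z -> v \in z :: s -> r z < r v.
  move=> vz /(allP Ps); rewrite leq_eqVlt => /orP[/eqP/r_inj zv|//].
  by rewrite zv eqxx in vz.
rewrite inE /weakly_accessible rL neq //=; last by rewrite -ls mem_last.
suff int : all (fun v => (z, v) \in L) (behead (belast z s)).
  have sp : size s < p.+1 by lia.
  apply/existsP; exists (Ordinal sp); apply/existsP; exists (in_tuple s).
  by apply/andP.
have sub : {subset behead (belast z s) <= s}.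
  by case: (s) => //= b t v vt; rewrite lastI mem_rcons inE vt orbT.
apply/allP => v /sub vs; rewrite rL neq ?inE ?vs ?orbT //.
by apply: contraTneq us => zv; rewrite /= -zv vs.
Qed.

(** Joining the two walks at [x] gives a weak walk to the smaller of [z] and [z'] from the larger,
    making it weakly accessible if they differ. *)
Lemma weak_walk_inj p (T : eqType) (a : G -> T) i j x z z' :
    (forall u v, u \in weak_reach L p v -> a u != a v) ->
    weak_walk i x z -> weak_walk j x z' -> i + j <= p -> a z = a z' -> z = z'.
Proof.
move=> aP; wlog zz' : i j z z' / r z <= r z'.
  move=> W wz wz' ijp azz'; have [le|lt] := leqP (r z) (r z').
    exact: W wz wz' ijp azz'.
  by apply/esym; apply: W wz' wz _ _; rewrite 1?addnC // ltnW.
move=> wz wz' ijp azz'; apply/eqP; rewrite eq_sym; apply/negPn/negP => nzz'.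
have w : weak_walk (j + i) z' z.
  apply: walk_cat wz; apply: walk_rev; apply: walk_sub wz' => v /=.
  exact: leq_trans.
have jip : j + i <= p by rewrite addnC.
by have := aP _ _ (weak_walk_accessible w jip nzz'); rewrite azz' eqxx.
Qed.

Lemma has_path_min p x y : has_path p x y ->
  exists z i, [/\ i <= p, weak_walk i x z & weak_walk (p - i) y z].
Proof.
case/existsP=> s /and3P[ps _ /eqP ls].
have [z zs zmin] := arg_minnP r (mem_head x s).
have xs : all (fun v => r z <= r v) (x :: s) by apply/allP.
have := size_tuple s; case/splitPl: zs ps ls xs => s1 s2 ls1.
rewrite cat_path last_cat -cat_cons all_cat => /andP[p1 p2] ly /andP[a1 a2].
rewrite size_cat => sz; exists z, (size s1); split; first by rewrite -sz leq_addr.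
  by apply/walkP; exists s1.
apply: walk_rev; apply/walkP; exists s2; rewrite -ls1; split=> //; first by rewrite -sz addKn.
by rewrite ls1 /= leqnn.
Qed.

Variables (p q : nat) (a : G -> 'I_q).
Hypothesis aP : forall u v, u \in weak_reach L p v -> a u != a v.

Definition near_colour x c j := [exists z, (a z == c) && weak_walk j x z].

(** When the search fails, [find] returns the length of the list, [p./2 + 1]. *)
Definition colour_dist x c := find (near_colour x c) (iota 0 (p./2).+1).

Lemma colour_dist_lt x c : colour_dist x c < p./2 + 2.
Proof. by rewrite addn2 ltnS (leq_trans (find_size _ _)) ?size_iota. Qed.

Lemma colour_dist_le i x z :
  weak_walk i x z -> i <= p./2 -> colour_dist x (a z) <= i.
Proof.
move=> w ip; rewrite leqNgt; apply/negP => /(before_find 0).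
by rewrite nth_iota // => /existsP[]; exists z; rewrite eqxx.
Qed.

Lemma colour_distP x c : colour_dist x c <= p./2 ->
  exists2 z, a z = c & weak_walk (colour_dist x c) x z.
Proof.
move=> lep; have : has (near_colour x c) (iota 0 (p./2).+1).
  by rewrite has_find size_iota.
move/(nth_find 0); rewrite nth_iota // => /existsP[z /andP[/eqP az w]].
by exists z.
Qed.

Definition colour_vector x := [ffun c => Ordinal (colour_dist_lt x c)].

Lemma colour_vector_eq x y : odd p -> has_path p x y ->
    colour_vector x = colour_vector y ->
  exists z i j, [/\ i <= p, j <= minn i (p - i) &
    [/\ weak_walk i x z, weak_walk (p - i) y z, weak_walk j x z
      & weak_walk j y z]].
Proof.
move=> op /has_path_min[z [i [ip wx wy]]] /ffunP/(_ (a z)).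
rewrite !ffunE => /(congr1 val) /= exy.
have p2 : p = (p./2).*2.+1 by rewrite -[LHS]odd_double_half op.
have jlei : colour_dist x (a z) <= minn i (p - i).
  (* As [p] is odd, exactly one of [i] and [p - i] is at most [p./2]; the entry is bounded from that
     end of the path. *)
  have [le|lt] := leqP i p./2.
    by have := colour_dist_le wx le; lia.
  by have := colour_dist_le (i := p - i) wy; rewrite exy; lia.
have [|z1 az1 w1] := @colour_distP x (a z); first by lia.
have [|z2 az2 w2] := @colour_distP y (a z); first by lia.
(* The bound by [minn i (p - i)] keeps both totals, [i + j] and [p - i + j], at most [p]. *)
have zz1 : z = z1 by apply: (weak_walk_inj aP wx w1) => //; lia.
have zz2 : z = z2 by apply: (weak_walk_inj aP wy w2) => //; lia.
exists z, i, (colour_dist x (a z)); do 2!split=> //; first by rewrite {2}zz1.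
by rewrite exy {2}zz2.
Qed.

End WeakWalks.

Lemma wcol_linear_order p (G : sgraph) :
  exists2 L : {set G * G}, linear_order L & wcol p G = (max_weak_reach L p).+1.
Proof.
rewrite /wcol; case: ex_minnP => m /existsP[L /andP[Llin /eqP Lm]] _.
by exists L; rewrite // Lm add1n.
Qed.

Lemma path_colouring p (G : sgraph) : odd p ->
  exists f : G -> {ffun 'I_(wcol p G) -> 'I_(p./2 + 2)},
  forall x y, has_path p x y -> f x = f y ->
  exists z i j, [/\ i <= p, j <= minn i (p - i) &
    [/\ walk predT i x z, walk predT (p - i) y z, walk predT j x z
      & walk predT j y z]].
Proof.
move=> op; have [L /linear_order_rank[r r_inj rL] ->] := wcol_linear_order p G.
have [|y|a aP] := @greedy_coloring G (weak_reach L p) r (max_weak_reach L p).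
- by move=> x y; rewrite inE => /andP[]; rewrite rL.
- by rewrite /max_weak_reach (leq_bigmax (F := fun y => #|weak_reach L p y|)).
exists (colour_vector r p a) => x y pxy.
case/(colour_vector_eq r_inj rL aP op pxy) => z [i [j [ip ji [w1 w2 w3 w4]]]].
have toT n u v : weak_walk r n u v -> walk predT n u v by apply: walk_sub.
by exists z, i, j; split=> //; split; apply: toT.
Qed.

Theorem theorem1p6 (p : nat) (G : sgraph) (hp : odd p) :
  chi (exact_dist_graph G p) <= (p./2 + 2) ^ wcol p G /\
  (odd_girth_geq G p.+1 ->
   chi (exact_power_graph G p) <= (p./2 + 2) ^ wcol p G).
Proof.
have [f fP] := @path_colouring p G hp.
have -> : (p./2 + 2) ^ wcol p G = #|{ffun 'I_(wcol p G) -> 'I_(p./2 + 2)}|.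
  by rewrite card_ffun !card_ord.
split=> [|og].
  apply: (@chi_leq_card (exact_dist_graph G p) _ f) => x y /andP[_ /eqP dxy].
  apply/eqP => /(fP _ _ (dist_has_path dxy))[z [i [j [ip ji [_ _ wx wy]]]]].
  have := dist_le_walk dxy (walk_cat wx (walk_rev wy)); lia.
apply: (@chi_leq_card (exact_power_graph G p) _ f) => x y /andP[_ pxy].
apply/eqP => /(fP _ _ pxy)[z [i [j [ip ji [w1 w2 wx wy]]]]].
have cx := walk_cat w1 (walk_rev wx); have cy := walk_cat w2 (walk_rev wy).
(* The two lengths add up to [p + 2j], which is odd. *)
have [o|o] : odd (i + j) \/ odd (p - i + j) by lia.
  by have := odd_girth_walk og o cx; lia.
by have := odd_girth_walk og o cy; lia.
Qed.
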